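(* Assume $m_1=m_2=m_3=m_4=1$ and $m_5=m_6$. Then there is a unique cross central configuration of the six-body problem $x=(x_1,\dots,x_6)\in\mathcal{X}$ satisfying the following conditions: (1) $x_1,x_2,x_3,x_4$ are collinear; (2) the polygon with vertices $x_2,x_3,x_5,x_6$ is a square centered at the origin of the coordinate system, such that $x_2,x_3$ are on the $y$-axis and $x_5,x_6$ are on the $x$-axis; (3) $r_{12}=r_{34}$ and $r_{14}=2$.
   Context: Let $x=(x_1,\dots,x_6)\in(\mathbb{R}^2)^6$ with $x_i\neq x_j$ for $i\ne j$, put $r_{ij}=\|x_i-x_j\|$, let $m_1,\dots,m_6$ be the masses, with $M=m_1+\cdots+m_6\neq0$, and let $c=\frac1M(m_1x_1+\cdots+m_6x_6)$. The configuration $x$ is called central if there is $\lambda\neq 0$ with $\sum_{j\neq i}m_j(x_j-x_i)r_{ij}^{-3}+\lambda(x_i-c)=0$ for $i=1,\dots,6$. A cross central configuration of the six-body problem (CC6BP) is a planar (non-collinear) central configuration of six bodies such that the set $\{x_1,\dots,x_6\}$ is symmetric with respect to a line $s$ containing exactly four of the six points. The bodies are indexed so that $x_1,x_2,x_3,x_4\in s$; then $x_5,x_6$ lie on a line $l$ perpendicular to $s$. Write $x_i=(x_{i1},x_{i2})$. $\mathcal{X}$ is the set of CC6BP normalized so that $c=0$, $l$ is parallel to the first coordinate axis (the $x$-axis), and (i) $x_{12}>x_{22}>x_{32}>x_{42}$; (ii) $x_{52}>x_{32}$; (iii) $x_{52}-x_{42}=1$; (iv) $x_{51}<x_{11}<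x_{61}$.
   Formalization: The common mass m_5=m_6 is not prescribed but is an unknown: exactly one x satisfies the conditions for some real masses with m_1=…=m_4=1 and m_5=m_6; for an arbitrary given value (e.g. m_5=m_6=1) no such configuration exists. *)

(* Defs.v *)
From HB Require Import structures.
From mathcomp Require Import all_boot all_order all_algebra.
From mathcomp Require Import boolp classical_sets reals.

Set Implicit Arguments.
Unset Strict Implicit.
Unset Printing Implicit Defensive.

Import Order.TTheory GRing.Theory Num.Theory.
Local Open Scope classical_set_scope.
Local Open Scope ring_scope.

(* The bodies 1, ..., 6, shifted to the 0-based indices of ['I_6]. *)
Definition b1 : 'I_6 := @Ordinal 6 0 isT.
Definition b2 : 'I_6 := @Ordinal 6 1 isT.
Definition b3 : 'I_6 := @Ordinal 6 2 isT.
Definition b4 : 'I_6 := @Ordinal 6 3 isT.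
Definition b5 : 'I_6 := @Ordinal 6 4 isT.
Definition b6 : 'I_6 := @Ordinal 6 5 isT.

Section PlaneGeometry.
Variable R : realType.
Implicit Types p q u v z A B C D : 'rV[R]_2.

Definition dot u v : R := \sum_(k < 2) u 0 k * v 0 k.

(* MathComp-Analysis equips ['rV[R]_2] with the sup norm, so the Euclidean
   distance is defined by hand. *)
Definition dist u v : R := Num.sqrt (dot (u - v) (u - v)).

(* A line only when [u != 0]. *)
Definition line p u : set 'rV[R]_2 := [set p + t *: u | t in [set: R]].

Definition reflection p u z : 'rV[R]_2 :=
  2 *: (p + (dot (z - p) u / dot u u) *: u) - z.

Definition collinear (S : set 'rV[R]_2) : Prop :=
  exists p u, u != 0 /\ S `<=` line p u.

(* The vertices are listed in cyclic order. *)
Definition square A B C D : Prop :=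
  [/\ A != B, B - A = C - D, dot (B - A) (C - B) = 0
    & dist A B = dist B C].

Definition square_center A B C D : 'rV[R]_2 := 4^-1 *: (A + B + C + D).

Definition x_axis : set 'rV[R]_2 := [set z | z 0 1 = 0].
Definition y_axis : set 'rV[R]_2 := [set z | z 0 0 = 0].

End PlaneGeometry.

Section SixBodies.
Variable R : realType.

(* A configuration is a 6 x 2 matrix: [row i x] is the position of body [i];
   [x i 0] and [x i 1] are its first and second coordinates. *)
Implicit Types (m : 'I_6 -> R) (x : 'M[R]_(6, 2)).

Definition rdist x (i j : 'I_6) : R := dist (row i x) (row j x).

Definition positions x : set 'rV[R]_2 := [set row i x | i in [set: 'I_6]].

Definition total_mass m : R := \sum_i m i.

Definition center_of_mass m x : 'rV[R]_2 :=
  (total_mass m)^-1 *: \sum_i m i *: row i x.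

Definition central m x : Prop :=
  [/\ total_mass m != 0,
      forall i j, i != j -> row i x != row j x
    & exists2 lambda : R, lambda != 0 &
      forall i, \sum_(j | j != i)
                   (m j * (rdist x i j) ^- 3) *: (row j x - row i x)
                + lambda *: (row i x - center_of_mass m x) = 0].

(* The symmetry line s is [line p u]; the equivalence says that s contains
   bodies 1 to 4 and no other, hence exactly four of the points. *)
Definition cc6bp m x : Prop :=
  [/\ central m x, ~ collinear (positions x)
    & exists p u : 'rV[R]_2,
      [/\ u != 0,
          reflection p u @` positions x = positions x
        & forall i : 'I_6, line p u (row i x) <-> (i < 4)%N]].

(* The second clause says that the horizontal line through body 5 contains
   body 6, i.e. that the line l through x_5 and x_6 is horizontal. *)
Definition calX m x : Prop :=
  [/\ cc6bp m x,
      center_of_mass m x = 0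
    & line (row b5 x) (delta_mx 0 0) (row b6 x)] /\
  [/\ x b1 1 > x b2 1 /\ x b2 1 > x b3 1 /\ x b3 1 > x b4 1,
      x b5 1 > x b3 1,
      x b5 1 - x b4 1 = 1
    & x b5 0 < x b1 0 < x b6 0].

Definition cond1 x : Prop :=
  collinear [set row i x | i in [set b1; b2; b3; b4]].

(* The cyclic order x_2, x_5, x_3, x_6 is forced: if x_2 and x_3 were adjacent,
   the parallel sides x_2x_3 and x_5x_6 would lie on perpendicular axes. *)
Definition cond2 x : Prop :=
  [/\ square (row b2 x) (row b5 x) (row b3 x) (row b6 x),
      square_center (row b2 x) (row b5 x) (row b3 x) (row b6 x) = 0,
      y_axis (row b2 x) /\ y_axis (row b3 x)
    & x_axis (row b5 x) /\ x_axis (row b6 x)].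

Definition cond3 x : Prop :=
  rdist x b1 b2 = rdist x b3 b4 /\ rdist x b1 b4 = 2.

End SixBodies.

(* Main.v *)
Require Import Defs.
From mathcomp Require Import all_boot all_order all_algebra.
From mathcomp Require Import boolp classical_sets reals.
From mathcomp Require Import perm topology normedtype realfun.
From mathcomp Require Import ring lra.
Import Order.TTheory GRing.Theory Num.Theory.
Import numFieldNormedType.Exports.
Set Implicit Arguments.
Unset Strict Implicit.
Unset Printing Implicit Defensive.
Local Open Scope ring_scope.

(* Conditions (1)-(3) force the positions (0,1), (0,b), (0,-b), (0,-1), (-b,0),
   (b,0) with 0 < b < 1.  By symmetry the central equations reduce to those of
   bodies 1, 2 and 6, which are affine in lambda and mu = m_5 = m_6.  Eliminating
   both leaves one equation [gap b = 0]: [gap] is negative on (0, 1/2], strictly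
   increasing on [1/2, 1) and positive at 3/5, so it has exactly one root.  There
   mu and lambda come out positive. *)

(** * The function [gap] and estimates for its ingredients *)

Section Gap.
Variable R : realType.
Implicit Types b c m l : R.

Definition isqrt2 : R := (Num.sqrt 2)^-1.
Local Notation q := isqrt2.

(* The distance from bodies 1 and 4 to bodies 5 and 6. *)
Definition hyp b : R := Num.sqrt (1 + b ^+ 2).
(** [4 * ecc b] is [b ^+ 2] times the net pull of bodies 1 and 4 on body 2, since 1/(1-b)^2 -
    1/(1+b)^2 = 4b/(1-b^2)^2. *)
Definition ecc b : R := b ^+ 3 / (1 - b ^+ 2) ^+ 2.
(** The cubed sine of the angle at body 1 between the y-axis and the direction of body 6; divided by
    [b ^+ 3] it is [hyp b ^- 3]. *)
Definition tcc b : R := (b / hyp b) ^+ 3.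

(* The numerator of the last balance equation once [m] and [l] are eliminated;
   see [balanced_gap]. *)
Definition gap b : R :=
  (q - 4^-1) * (2 * (1 + b ^+ 2) * ecc b + 4^-1 * b ^+ 3 - (q + 4^-1))
  + (2 * tcc b + 4 * ecc b) * (2 * tcc b - 4^-1).

Lemma isqrt2_sqr : q ^+ 2 = 2^-1.
Proof. by rewrite exprVn sqr_sqrtr. Qed.

Lemma isqrt2_gt0 : 0 < q.
Proof. by rewrite invr_gt0 sqrtr_gt0. Qed.

Lemma isqrt2_bounds : 5 / 8 <= q <= 3 / 4.
Proof. have := isqrt2_sqr; have := isqrt2_gt0; move: q => s s0 s2; apply/andP; split; nra. Qed.

Lemma hyp_sqr b : hyp b ^+ 2 = 1 + b ^+ 2.
Proof. by rewrite sqr_sqrtr // addr_ge0 // sqr_ge0. Qed.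

Lemma hyp_ge1 b : 1 <= hyp b.
Proof. by rewrite -[leLHS]sqrtr1 ler_wsqrtr // lerDl sqr_ge0. Qed.

Lemma hyp_gt0 b : 0 < hyp b.
Proof. exact: lt_le_trans ltr01 (hyp_ge1 b). Qed.

(** The last hypothesis is the squared conclusion, free of the root in [hyp], so numeric bounds on
    [tcc] become polynomial inequalities. *)
Lemma ler_cos_hyp b (a : R) : 0 <= b -> 0 <= a -> a ^+ 2 * (1 + b ^+ 2) <= b ^+ 2 ->
  a <= b / hyp b.
Proof.
move=> b0 a0 ab; rewrite ler_pdivlMr ?hyp_gt0 //.
by rewrite -ler_sqr ?nnegrE ?mulr_ge0 ?(ltW (hyp_gt0 b)) // exprMn hyp_sqr.
Qed.

Lemma tcc_ge b (a : R) : 0 <= b -> 0 <= a -> a ^+ 2 * (1 + b ^+ 2) <= b ^+ 2 ->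
  a ^+ 3 <= tcc b.
Proof. by move=> b0 a0 ab; rewrite lerXn2r ?nnegrE ?divr_ge0 ?(ltW (hyp_gt0 b)) ?ler_cos_hyp. Qed.

Lemma tcc_ge0 b : 0 <= b -> 0 <= tcc b.
Proof. by move=> b0; rewrite exprn_ge0 // divr_ge0 // ltW // hyp_gt0. Qed.

Lemma tcc_le b (a : R) : 0 <= b -> 0 <= a -> b ^+ 2 <= a ^+ 2 * (1 + b ^+ 2) ->
  tcc b <= a ^+ 3.
Proof.
move=> b0 a0 ab; have h0 := hyp_gt0 b.
rewrite lerXn2r ?nnegrE ?divr_ge0 ?(ltW h0) // ler_pdivrMr //.
by rewrite -ler_sqr ?nnegrE ?mulr_ge0 ?(ltW h0) // exprMn hyp_sqr.
Qed.

Lemma tcc_homo b c : 0 <= b -> b <= c -> tcc b <= tcc c.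
Proof.
move=> b0 bc; have h0 := hyp_gt0 b; have h2 := hyp_sqr b.
(* Taken with [a := b / hyp b], whose cube is [tcc b]. *)
apply: tcc_ge; rewrite ?divr_ge0 ?(ltW h0) //; first exact: le_trans bc.
rewrite expr_div_n h2 mulrAC ler_pdivrMr; first nra.
by rewrite -h2 exprn_gt0.
Qed.

Lemma one_sub_sqr_gt0 b : 0 <= b -> b < 1 -> 0 < 1 - b ^+ 2.
Proof. by move=> b0 b1; nra. Qed.

(** [ecc] is the cube times a factor that is at least 1 and increasing. Growth of the cube is the
    yardstick for comparing [ecc] with [tcc]. *)
Lemma cube_le_ecc_sub b c : 0 <= b -> b <= c -> c < 1 ->
  c ^+ 3 - b ^+ 3 <= ecc c - ecc b.
Proof.
move=> b0 bc c1; have c0 := le_trans b0 bc.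
have pc := one_sub_sqr_gt0 c0 c1.
have pb := one_sub_sqr_gt0 b0 (le_lt_trans bc c1).
have b3 : 0 <= b ^+ 3 by rewrite exprn_ge0.
have bc3 : b ^+ 3 <= c ^+ 3 by rewrite lerXn2r ?nnegrE.
have D1 : 1 <= ((1 - b ^+ 2) ^+ 2)^-1.
  by rewrite invf_ge1 ?exprn_gt0 // exprn_ile1 ?(ltW pb) // gerBl sqr_ge0.
have D2 : ((1 - b ^+ 2) ^+ 2)^-1 <= ((1 - c ^+ 2) ^+ 2)^-1.
  rewrite lef_pV2 ?posrE ?exprn_gt0 // lerXn2r ?nnegrE ?(ltW pb) ?(ltW pc) //.
  have : b ^+ 2 <= c ^+ 2 by rewrite lerXn2r ?nnegrE.
  lra.
rewrite /ecc; move: ((1 - b ^+ 2) ^+ 2)^-1 ((1 - c ^+ 2) ^+ 2)^-1 D1 D2 => d e D1 D2.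
move: (b ^+ 3) (c ^+ 3) b3 bc3 => u v u0 uv; nra.
Qed.

(** Dually, [tcc] is the cube times a factor that is at most 1 and decreasing. *)
Lemma tcc_sub_le_cube b c : 0 <= b -> b <= c -> tcc c - tcc b <= c ^+ 3 - b ^+ 3.
Proof.
move=> b0 bc; have c0 := le_trans b0 bc.
have S1 : (hyp b ^+ 3)^-1 <= 1 by rewrite invf_le1 ?exprn_gt0 ?hyp_gt0 // exprn_ege1 // hyp_ge1.
have S2 : (hyp c ^+ 3)^-1 <= (hyp b ^+ 3)^-1.
  rewrite lef_pV2 ?posrE ?exprn_gt0 ?hyp_gt0 // lerXn2r ?nnegrE ?(ltW (hyp_gt0 _)) //.
  by rewrite ler_wsqrtr // lerD2l lerXn2r ?nnegrE.
have b3 : 0 <= b ^+ 3 by rewrite exprn_ge0.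
have bc3 : b ^+ 3 <= c ^+ 3 by rewrite lerXn2r ?nnegrE.
rewrite /tcc !expr_div_n; move: (hyp b ^+ 3)^-1 (hyp c ^+ 3)^-1 S1 S2 => d e D1 D2.
move: (b ^+ 3) (c ^+ 3) b3 bc3 => u v u0 uv; nra.
Qed.

Lemma ecc_ge0 b : 0 <= b -> 0 <= ecc b.
Proof. by move=> b0; rewrite divr_ge0 ?sqr_ge0 // exprn_ge0. Qed.

(** * Sign and monotonicity of [gap] *)

Lemma gap_lt0 b : 0 < b -> b <= 2^-1 -> gap b < 0.
Proof.
move=> b0 bh; have /andP[q1 q2] := isqrt2_bounds.
have T0 := tcc_ge0 (ltW b0); have E0 := ecc_ge0 (ltW b0).
have T1 : tcc b <= 2^-1 ^+ 3 by apply: tcc_le; rewrite ?(ltW b0) //; nra.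
have b2 : b ^+ 2 <= 4^-1 by nra.
have b3 : b ^+ 3 <= 8^-1 by rewrite exprS; nra.
(* 2/9 is the value of [ecc] at 1/2. *)
have E1 : ecc b <= 2 / 9.
  rewrite /ecc ler_pdivrMr; last by rewrite exprn_gt0 //; nra.
  have : (3 / 4) ^+ 2 <= (1 - b ^+ 2) ^+ 2 by rewrite lerXn2r ?nnegrE //; nra.
  nra.
have B1 : (1 + b ^+ 2) * ecc b <= 5 / 4 * (2 / 9) by rewrite ler_pM //; nra.
rewrite /gap.
move: (tcc b) (ecc b) T0 E0 T1 E1 B1 => T E T0 E0 T1 E1 B1.
have : 2 * (1 + b ^+ 2) * E + 4^-1 * b ^+ 3 - (q + 4^-1) < 0 by lra.
have : (2 * T + 4 * E) * (2 * T - 4^-1) <= 0 by rewrite mulr_ge0_le0 //; lra.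
move=> h1 h2; rewrite ltr_wnDr // pmulr_rlt0 //; lra.
Qed.

Lemma gap_increasing b c : 2^-1 <= b -> b < c -> c < 1 -> gap b < gap c.
Proof.
move=> bh bc c1; have /andP[q1 q2] := isqrt2_bounds.
have b0 : 0 <= b by lra.
(* 2/5 is a rational lower bound for 1/sqrt 5, the value of [b / hyp b] at 1/2; twice its cube,
   16/125, still exceeds 1/8. *)
have T1 : (2 / 5) ^+ 3 <= tcc b by apply: tcc_ge => //; nra.
have hT := tcc_homo b0 (ltW bc).
have hE := cube_le_ecc_sub b0 (ltW bc) c1.
have hTE := tcc_sub_le_cube b0 (ltW bc).
have E0 := ecc_ge0 b0; have T0 := tcc_ge0 b0.
have h3 : b ^+ 3 < c ^+ 3 by rewrite ltrXn2r ?nnegrE //; lra.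
have hB : ecc c - ecc b <= (1 + c ^+ 2) * ecc c - (1 + b ^+ 2) * ecc b.
  have : b ^+ 2 * ecc b <= c ^+ 2 * ecc c by rewrite ler_pM ?sqr_ge0 //; nra.
  lra.
rewrite /gap; move: (tcc b) (tcc c) (ecc b) (ecc c) T1 hT hE hTE E0 T0 hB.
move=> T T' E E' T1 hT hE hTE E0 T0 hB.
(* The factor 2 T - 1/4 may be negative, but it is at least -1/8, and the growth
   of the first summand of [gap] absorbs the loss. *)
have P1 : (2 * T' + 4 * E') * (2 * T - 4^-1) <= (2 * T' + 4 * E') * (2 * T' - 4^-1).
  by apply: ler_wpM2l; lra.
have P2 : - (1 / 8) * (2 * (T' - T) + 4 * (E' - E))
   <= (2 * T - 4^-1) * (2 * (T' - T) + 4 * (E' - E)) by apply: ler_wpM2r; lra.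
set X := 2 * (1 + b ^+ 2) * E + _ - _; set Y := 2 * (1 + c ^+ 2) * E' + _ - _.
have P3 : (3 / 8) * (Y - X) <= (q - 4^-1) * (Y - X).
  by apply: ler_wpM2r; rewrite /X /Y; lra.
have P4 : 2 * (E' - E) + 4^-1 * (c ^+ 3 - b ^+ 3) <= Y - X by rewrite /X /Y; lra.
(* By P1-P4 the increase of [gap] is at least (E' - E)/4 - (T' - T)/4 + 3/32 (c^3 - b^3), which is
   positive because [hE] and [hTE] give T' - T <= E' - E. *)
lra.
Qed.

Lemma gap_inj b c : 0 < b < 1 -> 0 < c < 1 -> gap b = 0 -> gap c = 0 -> b = c.
Proof.
have main b' c' : 0 < b' -> b' < c' -> c' < 1 -> gap b' = 0 -> gap c' = 0 -> False.
  move=> b0 bc c1 gb gc.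
  have [bh|bh] := leP b' 2^-1; first by have := gap_lt0 b0 bh; rewrite gb ltxx.
  by have := gap_increasing (ltW bh) bc c1; rewrite gb gc ltxx.
move=> /andP[b0 b1] /andP[c0 c1] gb gc; case: (ltgtP b c) => // h; exfalso.
- exact: (main b c).
- exact: (main c b).
Qed.

(** The factor [2 * tcc b - 4^-1] changes sign at 1/sqrt 3 < 3/5, so at 3/5 the second summand is
    nonnegative, while the first is positive. *)
Lemma gap_gt0 : 0 < gap (3 / 5).
Proof.
have /andP[q1 q2] := isqrt2_bounds.
have T1 : (1 / 2) ^+ 3 <= tcc (3 / 5) by apply: tcc_ge => //; lra.
have E1 : 1 / 2 <= ecc (3 / 5) by rewrite /ecc ler_pdivlMr; nra.
rewrite /gap; move: (tcc _) (ecc _) T1 E1 => T E T1 E1.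
rewrite ltr_wpDr ?mulr_ge0 ?mulr_gt0 //; lra.
Qed.

(** * Root of [gap], and its equivalence with the balance equations *)

Lemma continuous_hyp : continuous hyp.
Proof.
move=> b; apply: (@continuous_comp _ _ _ (fun b => 1 + b ^+ 2) Num.sqrt).
  by apply: cvgD; [exact: cvg_cst | exact: exprn_continuous].
exact: sqrt_continuous.
Qed.

Lemma continuous_gap b : 0 <= b < 1 -> {for b, continuous gap}.
Proof.
move=> /andP[b0 b1].
have cX n (f : R -> R) : {for b, continuous f} -> {for b, continuous (fun x => f x ^+ n)}.
  by move=> cf; apply: (@continuous_comp _ _ _ f (fun y => y ^+ n)) => //; exact: exprn_continuous.
have cid : {for b, continuous (@id R)} by exact: cvg_id.
have cc (a : R) : {for b, continuous (fun=> a)} by exact: cvg_cst.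
have cE : {for b, continuous ecc}.
  apply: cvgM; first exact: cX.
  apply: cvgV; first by rewrite expf_neq0 // gt_eqF // one_sub_sqr_gt0.
  apply: (cX 2 (fun x => 1 - x ^+ 2)); apply: cvgB; [exact: cc | exact: cX].
have cT : {for b, continuous tcc}.
  apply: (cX 3 (fun x => x / hyp x)); apply: cvgM; first exact: cid.
  by apply: cvgV; [rewrite gt_eqF // hyp_gt0 | exact: continuous_hyp].
apply: cvgD.
  apply: cvgM; first exact: cc.
  apply: cvgB; last exact: cc.
  apply: cvgD; apply: cvgM; try exact: cE; try exact: cc; try exact: cX.
  by apply: cvgM; [exact: cc | apply: cvgD; [exact: cc | exact: cX]].
apply: cvgM.
  by apply: cvgD; apply: cvgM; try exact: cc.
by apply: cvgB; [apply: cvgM; [exact: cc|] | exact: cc].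
Qed.

Lemma gap_root : exists2 b, 0 < b < 1 & gap b = 0.
Proof.
have [|||b] := @IVT R gap 2^-1 (3 / 5) 0.
- lra.
- apply: continuous_in_subspaceT => b; rewrite inE /= in_itv /= => /andP[b0 b1].
  by apply: continuous_gap; apply/andP; split; lra.
- rewrite ge_min le_max (ltW gap_gt0) orbT andbT.
  by rewrite ltW // gap_lt0 //; lra.
by rewrite in_itv /= => /andP[b0 b1] gb; exists b => //; apply/andP; split; lra.
Qed.

(* The equations of bodies 1, 2 and 6, multiplied by b^3, b^2 and b^2. *)
Definition balanced b m l : Prop :=
  [/\ l * b ^+ 3 = 2 * (1 + b ^+ 2) * ecc b + 4^-1 * b ^+ 3 + 2 * m * tcc b,
      l * b ^+ 3 = 4^-1 - 4 * ecc b + m * q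
    & l * b ^+ 3 = 2 * tcc b + q + 4^-1 * m].

Lemma balanced_gap b m l : balanced b m l -> gap b = 0.
Proof.
move=> [e1 e2 e5].
(* Equating the second and third equations eliminates [l]. *)
have hm : m * (q - 4^-1) = q - 4^-1 + 2 * tcc b + 4 * ecc b.
  by apply/eqP; rewrite -subr_eq0; apply/eqP; lra.
have -> : gap b = (q - 4^-1) * (2 * (1 + b ^+ 2) * ecc b + 4^-1 * b ^+ 3 - 2 * tcc b - q)
  + (q - 4^-1 + 2 * tcc b + 4 * ecc b) * (2 * tcc b - 4^-1) by rewrite /gap; ring.
(* By [hm], [gap b] is [q - 4^-1] times the difference of the right-hand sides of the first and
   third equations. *)
rewrite -hm; transitivity ((q - 4^-1) * (l * b ^+ 3 - l * b ^+ 3)).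
  by rewrite {1}e1 e5; ring.
by rewrite subrr mulr0.
Qed.

Lemma gap_balanced b : 0 < b -> gap b = 0 ->
  exists m l, [/\ 0 < m, 0 < l & balanced b m l].
Proof.
move=> b0 gb; have /andP[q1 q2] := isqrt2_bounds.
have T0 := tcc_ge0 (ltW b0); have E0 := ecc_ge0 (ltW b0).
have k0 : 0 < q - 4^-1 by lra.
have b3 : 0 < b ^+ 3 by rewrite exprn_gt0.
(* The solution of the linear equation [hm], written so that its positivity is visible; [l] then
   comes from the third equation. *)
pose m := 1 + (2 * tcc b + 4 * ecc b) / (q - 4^-1).
have hm : m * (q - 4^-1) = q - 4^-1 + 2 * tcc b + 4 * ecc b.
  by rewrite /m mulrDl mul1r divfK ?gt_eqF //; ring.
have p0 : 0 <= (2 * tcc b + 4 * ecc b) / (q - 4^-1) by rewrite divr_ge0 ?(ltW k0) //; lra.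
have m0 : 0 < m by rewrite /m; lra.
pose l := (2 * tcc b + q + 4^-1 * m) / b ^+ 3.
have hl : l * b ^+ 3 = 2 * tcc b + q + 4^-1 * m by rewrite divfK ?gt_eqF.
exists m, l; split => //; first by rewrite divr_gt0 //; lra.
split => //; last by rewrite hl; lra.
rewrite hl; apply: (@mulfI _ (q - 4^-1)); first by rewrite gt_eqF.
apply/eqP; rewrite -subr_eq0; apply/eqP.
transitivity (- gap b + (q - 4^-1 + 2 * tcc b + 4 * ecc b - m * (q - 4^-1)) * (2 * tcc b - 4^-1)).
  by rewrite /gap; ring.
by rewrite hm gb; ring.
Qed.
End Gap.

(** * Coordinates of the cross and its central equations *)

Lemma ord6P (P : 'I_6 -> Prop) :
  P b1 -> P b2 -> P b3 -> P b4 -> P b5 -> P b6 -> forall i, P i.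
Proof.
move=> p1 p2 p3 p4 p5 p6 [[|[|[|[|[|[|//]]]]]] i6];
  [move: p1|move: p2|move: p3|move: p4|move: p5|move: p6];
  by congr P; apply: val_inj.
Qed.

Lemma big_ord6 (V : nmodType) (F : 'I_6 -> V) :
  \sum_i F i = F b1 + F b2 + F b3 + F b4 + F b5 + F b6.
Proof.
rewrite !big_ord_recl big_ord0 addr0 !addrA.
by do !congr (_ + _); congr F; apply: val_inj.
Qed.

Section Cross.
Variable R : realType.
Implicit Types (b l : R) (m : 'I_6 -> R) (x : 'M[R]_(6, 2)).

Local Notation q := (isqrt2 R).

Lemma rV2P (u v : 'rV[R]_2) : u 0 0 = v 0 0 -> u 0 1 = v 0 1 -> u = v.
Proof.
move=> h0 h1; apply/rowP => -[[|[|//]] i2].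
- by rewrite (_ : Ordinal i2 = 0) //; apply: val_inj.
- by rewrite (_ : Ordinal i2 = 1) //; apply: val_inj.
Qed.

Lemma dotE (u v : 'rV[R]_2) : dot u v = u 0 0 * v 0 0 + u 0 1 * v 0 1.
Proof.
rewrite /dot !big_ord_recl big_ord0 addr0.
by congr (_ + u _ _ * v _ _); apply: val_inj.
Qed.

Lemma distE (u v : 'rV[R]_2) :
  dist u v = Num.sqrt ((u 0 0 - v 0 0) ^+ 2 + (u 0 1 - v 0 1) ^+ 2).
Proof. by rewrite /dist dotE !mxE -!expr2. Qed.

Lemma rdistE x i j :
  rdist x i j = Num.sqrt ((x i 0 - x j 0) ^+ 2 + (x i 1 - x j 1) ^+ 2).
Proof. by rewrite /rdist distE !mxE. Qed.

Lemma line_det (p u a c d : 'rV[R]_2) : line p u a -> line p u c -> line p u d ->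
  (c 0 0 - a 0 0) * (d 0 1 - a 0 1) = (c 0 1 - a 0 1) * (d 0 0 - a 0 0).
Proof. by move=> [s _ <-] [t _ <-] [r _ <-]; rewrite !mxE; ring. Qed.

(* The left-hand side of the equation of body [i] in [central]. *)
Definition resultant m l x i : 'rV[R]_2 :=
  \sum_(j | j != i) (m j * (rdist x i j) ^- 3) *: (row j x - row i x)
  + l *: (row i x - center_of_mass m x).

(** The term [j = i] vanishes through its factor [x j k - x i k], so the sum can run over all six
    bodies. *)
Lemma resultantE m l x i k : center_of_mass m x = 0 ->
  resultant m l x i 0 k = \sum_j m j * (rdist x i j) ^- 3 * (x j k - x i k) + l * x i k.
Proof.
move=> c0; rewrite /resultant c0 subr0 !mxE; congr (_ + _).
rewrite summxE [RHS](bigD1 i) //= subrr mulr0 add0r.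
by apply: eq_bigr => j _; rewrite !mxE.
Qed.

Definition cross b : 'M[R]_(6, 2) :=
  \matrix_(i, k) nth 0 (nth [::] [:: [:: 0; 1]; [:: 0; b]; [:: 0; - b]; [:: 0; - 1];
                                     [:: - b; 0]; [:: b; 0]] i) k.

Lemma eq_cross b x :
  [/\ x b1 0 = 0, x b2 0 = 0, x b3 0 = 0 & x b4 0 = 0] ->
  [/\ x b1 1 = 1, x b2 1 = b, x b3 1 = - b & x b4 1 = - 1] ->
  [/\ x b5 0 = - b, x b6 0 = b, x b5 1 = 0 & x b6 1 = 0] -> x = cross b.
Proof.
move=> [h1 h2 h3 h4] [g1 g2 g3 g4] [f5 f6 e5 e6]; apply/row_matrixP.
by elim/ord6P; apply: rV2P; rewrite !mxE.
Qed.

Lemma sqrtr_eq (a c : R) : 0 <= a -> c = a ^+ 2 -> Num.sqrt c = a.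
Proof. by move=> a0 ->; rewrite sqrtr_sqr ger0_norm. Qed.

Lemma rdistC x i j : rdist x i j = rdist x j i.
Proof. by rewrite !rdistE; congr (Num.sqrt (_ + _)); rewrite -sqrrN opprB. Qed.

(** The product of equations acts as a single multi-rule for [rewrite]; pairs in the opposite order
    are first turned by [rdistC]. *)
Lemma rdist_cross b : 0 < b < 1 ->
  ((rdist (cross b) b1 b2 = (1 - b)%R) * (rdist (cross b) b1 b3 = (1 + b)%R) *
   (rdist (cross b) b1 b4 = (2)%R) * (rdist (cross b) b1 b5 = (hyp b)%R) *
   (rdist (cross b) b1 b6 = (hyp b)%R) * (rdist (cross b) b2 b3 = (2 * b)%R) *
   (rdist (cross b) b2 b4 = (1 + b)%R) * (rdist (cross b) b2 b5 = (b / q)%R) *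
   (rdist (cross b) b2 b6 = (b / q)%R) * (rdist (cross b) b3 b4 = (1 - b)%R) *
   (rdist (cross b) b3 b5 = (b / q)%R) * (rdist (cross b) b3 b6 = (b / q)%R) *
   (rdist (cross b) b4 b5 = (hyp b)%R) * (rdist (cross b) b4 b6 = (hyp b)%R) *
   (rdist (cross b) b5 b6 = (2 * b)%R))%type.
Proof.
move=> /andP[b0 b1'].
have q0 : 0 <= b / q by rewrite divr_ge0 ?ltW // isqrt2_gt0.
have q2 : (b / q) ^+ 2 = 2 * b ^+ 2 by rewrite expr_div_n isqrt2_sqr invrK mulrC.
by do !split; rewrite rdistE !mxE /=; first [
   by apply: sqrtr_eq; [lra | ring]
 | by rewrite /hyp; congr Num.sqrt; ring
 | by apply: sqrtr_eq; [| rewrite q2; ring]].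
Qed.

Definition cross_mass (mu : R) m : Prop :=
  [/\ m b1 = 1, m b2 = 1, m b3 = 1 & m b4 = 1] /\ (m b5 = mu /\ m b6 = mu).

Lemma center_of_mass_cross b mu m : cross_mass mu m -> center_of_mass m (cross b) = 0.
Proof.
move=> [[h1 h2 h3 h4] [h5 h6]].
rewrite /center_of_mass big_ord6 h1 h2 h3 h4 h5 h6.
rewrite (_ : _ + _ = 0) ?scaler0 //.
by apply: rV2P; rewrite !mxE /=; ring.
Qed.

(** The cross is symmetric in both axes, so each resultant lies along one axis and bodies 4, 3, 5
    mirror bodies 1, 2, 6: three scalar equations remain. *)
Lemma resultant_cross b mu m l : 0 < b < 1 -> cross_mass mu m ->
  let r1 := l * b ^+ 3 - (2 * (1 + b ^+ 2) * ecc b + 4^-1 * b ^+ 3 + 2 * mu * tcc b) in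
  let r2 := l * b ^+ 3 - (4^-1 - 4 * ecc b + mu * q) in
  let r5 := l * b ^+ 3 - (2 * tcc b + q + 4^-1 * mu) in
  forall i, resultant m l (cross b) i =
    nth 0 [:: (r1 / b ^+ 3) *: delta_mx 0 1; (r2 / b ^+ 2) *: delta_mx 0 1;
              - (r2 / b ^+ 2) *: delta_mx 0 1; - (r1 / b ^+ 3) *: delta_mx 0 1;
              - (r5 / b ^+ 2) *: delta_mx 0 0; (r5 / b ^+ 2) *: delta_mx 0 0] i.
Proof.
move=> b01 hm r1 r2 r5 i; have c0 := center_of_mass_cross b hm.
case: hm => -[h1 h2 h3 h4] [h5 h6].
have /andP[b0 b1'] := b01.
have q0 : q != 0 :> R by rewrite gt_eqF ?isqrt2_gt0.
have hq : (b / q) ^- 3 = q / (2 * b ^+ 3).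
  rewrite expr_div_n invf_div exprSr isqrt2_sqr; field; rewrite gt_eqF //.
have hh : hyp b ^- 3 = tcc b / b ^+ 3.
  by rewrite /tcc expr_div_n mulrC mulKf // expf_neq0 // gt_eqF.
have n0 : b != 0 by rewrite gt_eqF.
have n1 : 1 - b != 0 by rewrite gt_eqF // subr_gt0.
have n2 : 1 + b != 0 by rewrite gt_eqF //; lra.
have n3 : 1 - b ^+ 2 != 0 by rewrite gt_eqF // one_sub_sqr_gt0 // ltW.
apply: rV2P; rewrite resultantE // big_ord6 h1 h2 h3 h4 h5 h6;
 move: i; elim/ord6P.
all: rewrite ?(rdistC _ b2 b1) ?(rdistC _ b3 b1) ?(rdistC _ b4 b1) ?(rdistC _ b5 b1)
  ?(rdistC _ b6 b1) ?(rdistC _ b3 b2) ?(rdistC _ b4 b2) ?(rdistC _ b5 b2)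
  ?(rdistC _ b6 b2) ?(rdistC _ b4 b3) ?(rdistC _ b5 b3) ?(rdistC _ b6 b3)
  ?(rdistC _ b5 b4) ?(rdistC _ b6 b4) ?(rdistC _ b6 b5).
all: rewrite ?(rdist_cross b01) ?hq ?hh ?mxE /= ?subrr ?mulr0 ?mul0r.
all: rewrite /r1 /r2 /r5 /ecc ?(mulr0, mulr1, add0r, addr0) //.
all: by field; do ?(apply/andP; split).
Qed.

Lemma rV2_delta (c : R) k : c *: delta_mx 0 k = 0 :> 'rV[R]_2 -> c = 0.
Proof. by move=> /rowP/(_ k); rewrite !mxE !eqxx mulr1. Qed.

Lemma resultant_cross_eq0 b mu m l : 0 < b < 1 -> cross_mass mu m ->
  (forall i, resultant m l (cross b) i = 0) <-> balanced b mu l.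
Proof.
move=> b01 hm; have b0 : b != 0 by case/andP: b01 => b0 _; rewrite gt_eqF.
split=> [h|[e1 e2 e5] i]; last first.
  rewrite (resultant_cross l b01 hm) -e1 -e2 -e5 !subrr !mul0r oppr0 !scale0r.
  by elim/ord6P: i.
have H i := etrans (esym (resultant_cross l b01 hm i)) (h i).
have nz (r : R) n : r / b ^+ n = 0 -> r = 0.
  by move=> /eqP; rewrite mulf_eq0 invr_eq0 expf_eq0 (negbTE b0) andbF orbF => /eqP.
by split; apply/subr0_eq; [move: (H b1)|move: (H b2)|move: (H b6)] => /rV2_delta/nz.
Qed.

(** * Membership of the cross in [calX], and conditions (1)-(3) *)

Lemma vertical_lineP (z : 'rV[R]_2) : line 0 (delta_mx 0 1) z <-> z 0 0 = 0.
Proof.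
split=> [[t _ <-]|z0]; first by rewrite !mxE /= mulr0 addr0.
by exists (z 0 1) => //; apply: rV2P; rewrite !mxE /= ?mulr1 ?mulr0 add0r.
Qed.

(** Turns the reflection into a permutation of indices, so that the symmetry of [positions] follows
    from [tpermK]. *)
Lemma reflection_cross b i :
  reflection 0 (delta_mx 0 1) (row i (cross b)) = row (tperm b5 b6 i) (cross b).
Proof.
rewrite /reflection subr0 add0r !dotE !mxE /=.
have -> : (0 * 0 + 1 * 1 : R) = 1 by ring.
apply: rV2P; rewrite !mxE /=; elim/ord6P: i => /=;
  rewrite ?tpermL ?tpermR ?tpermD //= ?divr1; ring.
Qed.

Lemma central_cross b mu m l : 0 < b < 1 -> cross_mass mu m -> 0 < mu -> 0 < l ->
  balanced b mu l -> central m (cross b).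
Proof.
move=> b01 hm mu0 l0 hb; have /andP[b0 b1'] := b01; split.
- case: hm => -[h1 h2 h3 h4] [h5 h6].
  by rewrite /total_mass big_ord6 h1 h2 h3 h4 h5 h6 gt_eqF //; lra.
- move=> i j /eqP ij; apply/eqP => h; apply: ij.
  have h0 : cross b i 0 = cross b j 0 by move/rowP/(_ 0): h; rewrite !mxE.
  have h1 : cross b i 1 = cross b j 1 by move/rowP/(_ 1): h; rewrite !mxE.
  move: i j {h} h0 h1; elim/ord6P; elim/ord6P; rewrite !mxE //= => h0 h1; exfalso; lra.
- by exists l; [rewrite gt_eqF | exact/(resultant_cross_eq0 l b01 hm)].
Qed.

Lemma calX_cross b mu m l : 0 < b < 1 -> cross_mass mu m -> 0 < mu -> 0 < l ->
  balanced b mu l -> calX m (cross b).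
Proof.
move=> b01 hm mu0 l0 hb; have /andP[b0 b1'] := b01; split; split.
- split; first exact: central_cross hb.
  + move=> [p [u [_ h]]].
    have P i : line p u (row i (cross b)) by apply: h; exists i.
    (* Collinearity of bodies 1, 2 and 6 would force b(b - 1) = 0. *)
    by have := line_det (P b1) (P b2) (P b6); rewrite !mxE /=; nra.
  + exists 0, (delta_mx 0 1); split.
    * by apply/eqP => /rowP/(_ 1); rewrite !mxE; apply/eqP; rewrite oner_neq0.
    * rewrite eqEsubset; split=> [z [_ [i _ <-] <-]|z [i _ <-]].
        by rewrite reflection_cross; exists (tperm b5 b6 i).
      exists (row (tperm b5 b6 i) (cross b)); first by exists (tperm b5 b6 i).
      by rewrite reflection_cross tpermK.
    * by move=> i; rewrite vertical_lineP; elim/ord6P: i; rewrite !mxE /=; split=> //; lra.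
- exact: center_of_mass_cross hm.
- by exists (2 * b) => //; apply: rV2P; rewrite !mxE /=; ring.
- by rewrite !mxE /=; split; last split; lra.
- by rewrite !mxE /=; lra.
- by rewrite !mxE /=; lra.
- by rewrite !mxE /=; apply/andP; split; lra.
Qed.

Lemma cond1_cross b : cond1 (cross b).
Proof.
exists 0, (delta_mx 0 1); split.
  by apply/eqP => /rowP/(_ 1); rewrite !mxE; apply/eqP; rewrite oner_neq0.
by move=> _ [i hi <-]; apply/vertical_lineP; case: hi => [[[]|]|] ->; rewrite !mxE.
Qed.

Lemma cond2_cross b : 0 < b -> cond2 (cross b).
Proof.
move=> b0; split; last first.
- by rewrite /x_axis /= !mxE.
- by rewrite /y_axis /= !mxE.
- by apply: rV2P; rewrite !mxE /=; ring.
split.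
- by apply/eqP => /rowP/(_ 0); rewrite !mxE /=; lra.
- by apply: rV2P; rewrite !mxE /=; ring.
- by rewrite dotE !mxE /=; ring.
- by rewrite !distE !mxE /=; congr Num.sqrt; ring.
Qed.

Lemma cond3_cross b : 0 < b < 1 -> cond3 (cross b).
Proof. by move=> b01; split; rewrite !(rdist_cross b01). Qed.

(** * The shape forced by the conditions, and uniqueness *)

Lemma cross_form m x : calX m x -> cond1 x -> cond2 x -> cond3 x ->
  exists2 b, 0 < b < 1 & x = cross b.
Proof.
move=> [_ [[x12 [x23 x34]] _ x54 /andP[x51 _]]] [p [u [_ hl]]].
move=> [[_ _ hdot _] hc [y2 y3] [z5 z6]] [_ r14].
move: y2 y3 z5 z6; rewrite /x_axis /y_axis /= !mxE => y2 y3 z5 z6.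
have c0 : x b2 0 + x b5 0 + x b3 0 + x b6 0 = 0.
  by move/rowP/(_ 0): hc; rewrite !mxE; lra.
have c1 : x b2 1 + x b5 1 + x b3 1 + x b6 1 = 0.
  by move/rowP/(_ 1): hc; rewrite !mxE; lra.
have P i : [set b1; b2; b3; b4]%classic i -> line p u (row i x) by move=> hi; apply: hl; exists i.
have P1 : line p u (row b1 x) by apply: P; do 3 left.
have P2 : line p u (row b2 x) by apply: P; do 2 left; right.
have P3 : line p u (row b3 x) by apply: P; left; right.
have P4 : line p u (row b4 x) by apply: P; right.
(* Bodies 2 and 3 are distinct points of the y-axis, so the line containing bodies 1 to 4 is that
   axis. *)
have y1 : x b1 0 = 0 by have := line_det P2 P3 P1; rewrite !mxE y2 y3; nra.
have y4 : x b4 0 = 0 by have := line_det P2 P3 P4; rewrite !mxE y2 y3; nra.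
(* Body 5 has height 0 and lies 1 above body 4; [r14] and the vertical order then place body 1. *)
have e4 : x b4 1 = - 1 by lra.
have e1 : x b1 1 = 1.
  move: r14; rewrite rdistE y1 y4 e4 subrr expr0n add0r sqrtr_sqr opprK ger0_norm; lra.
move: hdot; rewrite dotE !mxE y2 y3 z5 => hdot.
have e3 : x b3 1 = - x b2 1 by lra.
(* The right angle at body 5 gives equal squares; the sign comes from body 5 lying left of body 1
   and body 2 lying above body 3. *)
have e5 : x b5 0 = - x b2 1.
  have : (x b5 0 + x b2 1) * (x b5 0 - x b2 1) = 0 by move: hdot; rewrite e3 => hdot; lra.
  by move/eqP; rewrite mulf_eq0 => /orP[] /eqP; lra.
exists (x b2 1); first by apply/andP; split; lra.
by apply: eq_cross; split => //; lra.
Qed.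

End Cross.

Theorem proposition5p2 (R : realType) :
  exists! x : 'M[R]_(6, 2), exists m : 'I_6 -> R,
    ([/\ m b1 = 1, m b2 = 1, m b3 = 1 & m b4 = 1] /\ m b5 = m b6) /\
    [/\ calX m x, cond1 x, cond2 x & cond3 x].
Proof.
have [b b01 gb] := gap_root R; have /andP[b0 _] := b01.
have [mu [l [mu0 l0 hb]]] := gap_balanced b0 gb.
exists (cross b); split.
  pose m (i : 'I_6) : R := if (i < 4)%N then 1 else mu.
  have hm : cross_mass mu m by [].
  exists m; split=> //; split.
  - exact: calX_cross hm mu0 l0 hb.
  - exact: cond1_cross.
  - exact: cond2_cross.
  - exact: cond3_cross.
move=> x [m [[[h1 h2 h3 h4] h56] [hX hc1 hc2 hc3]]].
have [c c01 xc] := cross_form hX hc1 hc2 hc3; subst x; congr cross.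
case: hX => -[[[_ _ [k _ hk]] _ _] _ _] _.
have hm : cross_mass (m b6) m by do !split.
(* The mass [m b6] and multiplier [k] are not assumed equal to [mu] and [l], but [gap] contains
   neither, so both configurations give roots of the same function. *)
apply: gap_inj => //; apply: balanced_gap.
exact/(resultant_cross_eq0 k c01 hm).
Qed.
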